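(* Let $\sigma,\kappa>0$, $v\ge0$, let $\vartheta$ be a bijective path in $C_0(\mathbb{R}_+,\mathbb{R}_+)$, and let $Z=\{Z_x\}_{x\in\mathbb{R}_+}$ be a stochastic process with paths a.s. in $C_0(\mathbb{R}_+,\mathbb{R})$ and a.s. verifying $\sup_{x\in\mathbb{R}_+}\kappa x-\sigma Z_x=\infty$. Let $Y_{t,x}:=\sigma Z_x+\kappa(\vartheta(t)-x)+v$ and let $X=\{X_t\}_{t\in\mathbb{R}_+}$ be the unique solution of the random initial value problem $x'=Y_{t,x}$, $x_0=0$. Provided that $Z$ is a centred Gaussian process which verifies $\mathbb{E}[Z_x^2]<\alpha+\beta x^\gamma$ (for $x\in\mathbb{R}_+$) for some $\alpha,\beta\ge0$ and $\gamma\in(0,1)$, the moment generating function $M_X(p,t):=\mathbb{E}[e^{pX_t}]$ exists (is finite) for all $(p,t)\in\mathbb{R}\times\mathbb{R}_+$, regardless of how the parameters $\sigma,\kappa,\vartheta,v$ are chosen.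
   Context: $\mathbb{R}_+=[0,\infty)$; $C_0$ denotes continuous paths starting from $0$ at $0$. A process $X$ is the solution of the random initial value problem $x'=Y_{t,x}$, $x_0=0$ if almost surely $X_0=0$, $X$ is continuously differentiable on $\mathbb{R}_+$ and $X'_t=Y_{t,X_t}$ for all $t\in\mathbb{R}_+$. For $Y$ as in the statement such a solution exists, is unique up to indistinguishability, a.s. has paths that are bijections in $C^1_0(\mathbb{R}_+,\mathbb{R}_+)$, and is dominated by the process $\overline{X}_t:=\inf\{x>0:Y_{t,x}<0\}$. *)

(* Defs.v *)
From HB Require Import structures.
From mathcomp Require Import all_boot all_order all_algebra.
From mathcomp Require Import all_classical all_reals all_analysis.

Set Implicit Arguments.
Unset Strict Implicit.
Unset Printing Implicit Defensive.

Import Order.TTheory GRing.Theory Num.Theory numFieldNormedType.Exports.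

Local Open Scope classical_set_scope.
Local Open Scope ring_scope.

(* Functions and processes on [0, +oo[ are encoded as functions on R, of which
   only the values at nonnegative arguments are ever constrained or used. *)
Definition Rplus {R : realType} : set R := [set x | 0 <= x].

(* f restricted to [0, +oo[ is a path of C_0: continuous (for the subspace
   topology, hence only right-continuity at 0) and started from 0. *)
Definition C0path {R : realType} (f : R -> R) : Prop :=
  f 0 = 0 /\ {within Rplus, continuous f}.

(* f is differentiable on [0, +oo[ with derivative f'; at an interior point
   this is the usual derivative, at 0 the right one. *)
Definition derivative_on_Rplus {R : realType} (f f' : R -> R) : Prop :=
  forall t, 0 <= t ->
    (f s - f t) / (s - t) @[s --> within Rplus t^'] --> f' t.

(* The path x solves x' = Y_(t, x), x_0 = 0.  Since Y is a field on
   [0, +oo[ x [0, +oo[, a solution takes nonnegative values. *)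
Definition solves_ivp {R : realType} (Y : R -> R -> R) (x : R -> R) : Prop :=
  [/\ x 0 = 0, forall t, 0 <= t -> 0 <= x t &
      exists x' : R -> R,
        [/\ derivative_on_Rplus x x',
            {within Rplus, continuous x'} &
            forall t, 0 <= t -> x' t = Y t (x t)]].

(* Gaussian laws on R, Dirac masses (zero variance) included;
   [normal_prob m 0] is not a Dirac mass, so this case is separate. *)
Definition gaussian_law {R : realType} (mu : set R -> \bar R) : Prop :=
  exists m s : R, 0 <= s /\
    forall A : set R, measurable A ->
      mu A = if s == 0 then \d_m A else normal_prob m s A.

(* Gaussian process indexed by [0, +oo[: every finite linear combination of its
   values is Gaussian, i.e. all finite-dimensional laws are multivariate
   (possibly degenerate) Gaussian. *)
Definition gaussian_process {d : measure_display} {T : measurableType d}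
    {R : realType} (P : probability T R) (Z : R -> {RV P >-> R}) : Prop :=
  forall (n : nat) (a x : 'I_n -> R), (forall i, 0 <= x i) ->
    gaussian_law (fun A : set R =>
      P ((fun w => \sum_(i < n) a i * Z (x i) w) @^-1` A)).

Definition centred_process {d : measure_display} {T : measurableType d}
    {R : realType} (P : probability T R) (Z : R -> {RV P >-> R}) : Prop :=
  forall x, 0 <= x -> ('E_P[Z x] = 0)%E.

(* Y_(t, x) = sigma Z_x + kappa (theta(t) - x) + v along one path z of Z. *)
Definition Yfield {R : realType} (sigma kappa v : R) (theta z : R -> R)
    (t x : R) : R :=
  sigma * z x + kappa * (theta t - x) + v.

(* Main.v *)
Require Import Defs.
From HB Require Import structures.
From mathcomp Require Import all_boot all_order all_algebra.
From mathcomp Require Import all_classical all_reals all_analysis.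
From mathcomp Require Import measurable_realfun ring lra.

Set Implicit Arguments.
Unset Strict Implicit.
Unset Printing Implicit Defensive.

Import Order.TTheory GRing.Theory Num.Theory numFieldNormedType.Exports.

Local Open Scope classical_set_scope.
Local Open Scope ring_scope.

(* Where [X] first reaches a level [x <= X_t] its derivative is nonnegative, so
   [0 <= sigma Z_x - kappa x + c] with [c := kappa * sup_[0, t] theta + v].
   Taking [x := n] the integer part of [X_t], for every [lam >= 0]
     [expR (p X_t) <= expR (|p| (n + 1) + lam (sigma Z_n - kappa n + c))],
   and the right-hand side is at most its sum over all [n].  Integrating, the
   Gaussian moment generating function contributes [expR (O (1 + n^gamma))],
   which is dominated by the linear exponent as soon as [lam kappa > |p|]
   since [gamma < 1], and the series is bounded by a geometric one. *)

(** * Differentiable paths and the first hitting time of a level *)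

Lemma derivative_on_RplusP {R : realType} (f f' : R -> R) (s e : R) :
  derivative_on_Rplus f f' -> 0 <= s -> 0 < e ->
  exists2 r : R, 0 < r & forall u, 0 <= u -> u != s -> `|u - s| < r ->
    `|f' s - (f u - f s) / (u - s)| < e.
Proof.
move=> df s0 e0; have /cvgrPdist_lt/(_ _ e0) := df s s0.
rewrite near_withinE => /nbhs_ballP[r /= r0 H].
exists r => // u u0 us usr; apply: H => //=.
by rewrite /ball/= distrC.
Qed.

(** Near [s] the difference quotients are bounded by [|f' s| + 1], which yields continuity in
    epsilon-delta form. *)
Lemma derivative_on_Rplus_dist_lt {R : realType} (f f' : R -> R) (s e : R) :
  derivative_on_Rplus f f' -> 0 <= s -> 0 < e ->
  exists2 r : R, 0 < r & forall u, 0 <= u -> `|u - s| < r ->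
    `|f u - f s| < e.
Proof.
move=> df s0 e0; have [r r0 H] := derivative_on_RplusP df s0 ltr01.
pose C := `|f' s| + 1.
have C0 : 0 < C by rewrite ltr_wpDl.
exists (Num.min r (e / C)); first by rewrite lt_min r0 divr_gt0.
move=> u u0; rewrite lt_min => /andP[ur ue].
have [->|us] := eqVneq u s; first by rewrite subrr normr0.
have us0 : u - s != 0 by rewrite subr_eq0.
have qC : `|(f u - f s) / (u - s)| <= C.
  rewrite -[X in `|X|](subKr (f' s)) (le_trans (ler_normB _ _))// lerD2l.
  exact/ltW/H.
rewrite -(divfK us0 (f u - f s)) normrM.
rewrite (le_lt_trans (ler_wpM2r (normr_ge0 _) qC))//.
by rewrite mulrC -ltr_pdivlMr.
Qed.

(* At the first time the level [x] is reached, the left difference quotients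
   are positive. *)
Lemma exists_hit_derivative_ge0 {R : realType} (f f' : R -> R) (t x : R) :
  derivative_on_Rplus f f' -> f 0 = 0 -> 0 <= t -> 0 < x -> x <= f t ->
  exists s, [/\ 0 <= s, s <= t, f s = x & 0 <= f' s].
Proof.
move=> df f0 t0 x0 xt.
pose S := [set s | [/\ 0 <= s, s <= t & x <= f s]].
have St : S t by split.
have lbS : lbound S 0 by move=> s [].
have hiS : has_inf S by split; [exists t | exists 0].
pose s0 := inf S.
have s0_ge0 : 0 <= s0 by exact: lb_le_inf (ex_intro _ t St) lbS.
have s0_min s : S s -> s0 <= s by move=> Ss; apply: ge_inf => //; exact: hiS.2.
have s0t : s0 <= t by exact: s0_min.
(* The infimum is attained: if [f s0 < x], continuity would keep [f] below [x] just after [s0],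
   where [S] has points. *)
have xs0 : x <= f s0.
  rewrite leNgt; apply/negP => fs0x.
  have [r r0 H] :=
    derivative_on_Rplus_dist_lt df s0_ge0 (etrans (subr_gt0 _ _) fs0x).
  have [u Su us0] := inf_adherent r0 hiS.
  have s0u := s0_min _ Su; case: Su => u0 ut xfu.
  have := H u u0; rewrite ger0_norm ?subr_ge0// ltrBlDl => /(_ us0).
  rewrite ger0_norm ?subr_ge0 ?(le_trans (ltW fs0x))//.
  by rewrite ltrD2r ltNge xfu.
have s0_gt0 : 0 < s0.
  rewrite lt_neqAle s0_ge0 andbT eq_sym; apply/eqP => s00.
  by move: xs0; rewrite s00 f0 leNgt x0.
(* Since [0 < s0], there are admissible times arbitrarily close to [s0] on its left; the maximum
   with 0 keeps them in the domain. *)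
have left r : 0 < r -> exists2 u, 0 <= u < s0 & `|u - s0| < r.
  move=> r0; exists (Num.max 0 (s0 - r / 2)).
    by rewrite le_max lexx/= gt_max s0_gt0/= ltrBlDr ltrDl divr_gt0.
  rewrite distrC ger0_norm; last first.
    by rewrite subr_ge0 ge_max s0_ge0 gerBl divr_ge0// ltW.
  rewrite ltrBlDl -ltrBlDr lt_max; apply/orP; right; lra.
have lt_s0 u : 0 <= u -> u < s0 -> f u < x.
  move=> u0 us0; rewrite ltNge; apply/negP => xfu.
  have : s0 <= u by apply: s0_min; split=> //; rewrite (le_trans (ltW us0)).
  by rewrite leNgt us0.
have fs0 : f s0 = x.
  apply/eqP; rewrite eq_le xs0 andbT leNgt; apply/negP => xfs0.
  have [r r0 H] :=
    derivative_on_Rplus_dist_lt df s0_ge0 (etrans (subr_gt0 _ _) xfs0).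
  have [u /andP[u0 us0] ur] := left r r0.
  have := H u u0 ur; have := lt_s0 u u0 us0.
  rewrite ltr_distlC; lra.
exists s0; split=> //; rewrite leNgt; apply/negP => f's0.
have f's0' : 0 < - f' s0 by rewrite oppr_gt0.
have [r r0 H] := derivative_on_RplusP df s0_ge0 f's0'.
have [u /andP[u0 us0] ur] := left r r0.
have := H u u0 (negbT (lt_eqF us0)) ur.
have : 0 < (f u - f s0) / (u - s0).
  by rewrite nmulr_rgt0 ?invr_lt0 ?subr_lt0// fs0 lt_s0.
by rewrite ltr_norml; set q := _ / _; lra.
Qed.

(** * Exponential integrals and small intervals under a normal law *)

Lemma ge0_integral_normal_prob {R : realType} (m s : R) (f : R -> \bar R) :
  measurable_fun [set: R] f -> (forall x, 0 <= f x)%E ->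
  (\int[normal_prob m s]_(x in [set: R]) f x =
   \int[lebesgue_measure]_x (f x * (normal_pdf m s x)%:E))%E.
Proof.
move=> mf f0; have dom := normal_prob_dominates m s.
have mpdf : measurable_fun [set: R] (fun x => (normal_pdf m s x)%:E).
  by apply/measurable_EFinP; exact: measurable_normal_pdf.
rewrite -(Radon_Nikodym_SigmaFinite.change_of_variables dom f0)//.
apply: ge0_ae_eq_integral => //.
- apply: emeasurable_funM => //.
  exact: measurable_int (Radon_Nikodym_SigmaFinite.f_integrable dom).
- exact: emeasurable_funM.
- by move=> x _; rewrite mule_ge0 ?Radon_Nikodym_SigmaFinite.f_ge0.
- by move=> x _; rewrite mule_ge0 ?lee_fin ?normal_pdf_ge0.
(* The Radon-Nikodym derivative and [normal_pdf] have the same integral over every measurable set,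
   hence agree almost everywhere. *)
- apply: ae_eqe_mul2l; apply: integral_ae_eq => //.
    exact: Radon_Nikodym_SigmaFinite.f_integrable.
  by move=> E _ mE; rewrite -Radon_Nikodym_SigmaFinite.f_integral.
Qed.

(** Completing the square: exponential tilting shifts the mean by [r * s ^+ 2]. *)
Lemma expRM_normal_pdf {R : realType} (m s r x : R) : s != 0 ->
  expR (r * x) * normal_pdf m s x =
  expR (r * m + (r * s) ^+ 2 / 2) * normal_pdf (m + r * s ^+ 2) s x.
Proof.
move=> s0; rewrite !normal_pdfE// /normal_fun !(mulrCA (expR _)) -!expRD.
congr (_ * expR _); field.
by rewrite s0.
Qed.

Lemma measurable_expRM {R : realType} (r : R) :
  measurable_fun [set: R] (fun x => (expR (r * x))%:E).
Proof.
apply/measurable_EFinP; apply: (measurableT_comp (@measurable_expR R)).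
exact: mulrl_measurable.
Qed.

Lemma integral_expR_normal_prob {R : realType} (m s r : R) : s != 0 ->
  (\int[normal_prob m s]_(x in [set: R]) (expR (r * x))%:E =
   (expR (r * m + (r * s) ^+ 2 / 2))%:E)%E.
Proof.
move=> s0; rewrite ge0_integral_normal_prob//; last first.
  exact: measurable_expRM.
under eq_integral do rewrite -EFinM expRM_normal_pdf// EFinM.
rewrite ge0_integralZl_EFin ?expR_ge0 ?integral_normal_pdf ?mule1//.
- by move=> x _; rewrite lee_fin normal_pdf_ge0.
- by apply/measurable_EFinP; exact: measurable_normal_pdf.
Qed.

Lemma normal_prob_sym_itv_le {R : realType} (m s d : R) : s != 0 -> 0 <= d ->
  (normal_prob m s `[(- d)%R, d] <= (2 * d * normal_peak s)%R%:E)%E.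
Proof.
move=> s0 d0; apply: (@le_trans _ _
  (\int[lebesgue_measure]_(x in `[(- d)%R, d]) (normal_peak s)%:E)%E).
  apply: ge0_le_integral => //=.
  - by move=> x _; rewrite lee_fin normal_pdf_ge0.
  - by apply/measurable_EFinP/measurable_funTS; exact: measurable_normal_pdf.
  - by move=> x _; rewrite lee_fin normal_pdf_ub.
rewrite integral_cst//= lebesgue_measure_itv/= lte_fin.
case: ifPn => [_|_]; last by rewrite mule0 lee_fin !mulr_ge0// normal_peak_ge0.
rewrite -EFinB -EFinM lee_fin le_eqVlt; apply/orP; left; apply/eqP; ring.
Qed.

(** * Moments of Gaussian random variables *)

Section gaussian_rv.
Context {d : measure_display} {T : measurableType d} {R : realType}.
Variable P : probability T R.

Lemma markov_sqr (Z : {RV P >-> R}) (e : R) : 0 <= e ->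
  ((e ^+ 2)%R%:E * (1 - P (Z @^-1` `[(- e)%R, e]))
    <= 'E_P[(fun w => (Z w ^+ 2)%R)])%E.
Proof.
move=> e0; have mA : measurable (Z @^-1` `[(- e)%R, e]).
  by rewrite -[_ @^-1` _]setTI; exact: measurable_funPT.
rewrite -probability_setC// [in leRHS]unlock.
rewrite -[X in P X]setIT -integral_indic//; last exact: measurableC.
rewrite -ge0_integralZl_EFin//; last 2 first.
  by apply/measurable_EFinP/measurable_indic/measurableC.
  exact: sqr_ge0.
apply: ge0_le_integral => //.
- by move=> w _; rewrite mule_ge0// lee_fin sqr_ge0.
- apply/measurable_funeM/measurable_EFinP/measurable_indic/measurableC => //.
- by apply/measurable_EFinP; exact: measurable_funX.
- move=> w _; rewrite -EFinM lee_fin indicE.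
  case: (boolP (w \in _)) => [|_]; last by rewrite mulr0 sqr_ge0.
  rewrite inE/= in_itv/= -ler_norml mulr1 => /negP; rewrite -ltNge => /ltW eZ.
  by rewrite -(real_normK (num_real (Z w))) ler_sqr ?nnegrE.
Qed.

(** The last clause links the parameter [s] to the second moment without computing the latter: a
    normal law puts little mass near 0, so Markov's inequality bounds the second moment from below.
    The constant 8 is not sharp. *)
Lemma gaussian_law_mgf (Z : {RV P >-> R}) :
  gaussian_law (fun A => P (Z @^-1` A)) ->
  exists m s : R, [/\ 0 <= s,
    forall r, ('M_P Z r = (expR (r * m + (r * s) ^+ 2 / 2))%:E)%E &
    ((s ^+ 2 / 8)%:E <= 'E_P[(fun w => (Z w ^+ 2)%R)])%E].
Proof.
move=> [m [s [s0 law]]]; exists m, s; split=> // [r|].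
  have mZ : measurable_fun [set: T] (Z : T -> measurableTypeR R).
    exact: (measurable_funPT Z : measurable_fun [set: T] (Z : T -> R)).
  (* The same map with codomain [measurableTypeR R], so that its distribution can be compared with
     the Dirac and normal measures on that type. *)
  pose Z' : {RV P >-> measurableTypeR R} :=
    HB.pack (Z : T -> measurableTypeR R) (isMeasurableFun.Build _ _ _ _ _ mZ).
  have -> : 'M_P Z r = (\int[distribution P Z']_x (expR (r * x))%:E)%E.
    rewrite ge0_integral_distribution//=; last exact: measurable_expRM.
    rewrite /mmt_gen_fun unlock; apply: eq_integral => w _ /=.
    by rewrite mulrC.
  have [s00|s_neq0] := eqVneq s 0.
    rewrite s00 mulr0 expr0n/= mul0r addr0.
    rewrite (@eq_measure_integral _ (measurableTypeR R) R _
      (dirac (m : measurableTypeR R)))/=.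
      by rewrite integral_dirac// ?diracT ?mul1e//; exact: measurable_expRM.
    by move=> A mA _; have := law A mA; rewrite s00 eqxx.
  rewrite -(integral_expR_normal_prob _ _ s_neq0).
  apply: eq_measure_integral => A mA _.
  by have := law A mA; rewrite (negbTE s_neq0).
have [->|s_neq0] := eqVneq s 0.
  rewrite expr0n mul0r unlock integral_ge0// => w _.
  by rewrite lee_fin sqr_ge0.
have pk0 := normal_peak_gt0 s_neq0.
(* For this [e], the interval [-e, e] has mass at most 1/2. *)
pose e := (4 * normal_peak s)^-1.
have e0 : 0 <= e by rewrite invr_ge0 mulr_ge0// ltW.
apply: le_trans (markov_sqr Z e0).
have PA : (P (Z @^-1` `[(- e)%R, e]) <= (2^-1)%:E)%E.
  rewrite law// (negbTE s_neq0) (le_trans (normal_prob_sym_itv_le _ _ _))//.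
  rewrite lee_fin /e le_eqVlt; apply/orP; left; apply/eqP; field.
  exact: lt0r_neq0.
apply: (@le_trans _ _ ((e ^+ 2)%R%:E * (1 - (2^-1)%:E))%E); last first.
  by rewrite lee_wpmul2l ?lee_fin ?sqr_ge0// leeB.
rewrite -EFinB -EFinM lee_fin.
have -> : e ^+ 2 = s ^+ 2 * pi *+ 2 / 16.
  rewrite /e /normal_peak invfM invrK exprMn sqr_sqrtr; first by field.
  by rewrite mulrn_wge0// mulr_ge0 ?sqr_ge0 ?pi_ge0.
(* Half of [e ^+ 2] is [s ^+ 2 * pi / 16], at least [s ^+ 2 / 8] because [2 <= pi]. *)
have := pi_ge2 R; have := sqr_ge0 s; nra.
Qed.

(** Domination by [1 + Z ^+ 2]. *)
Lemma sqr_integrable (Z : {RV P >-> R}) :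
  ('E_P[(fun w => (Z w ^+ 2)%R)] < +oo)%E ->
  P.-integrable [set: T] (EFin \o Z).
Proof.
rewrite unlock => Z2.
have mZ2 : measurable_fun [set: T] (fun w => (Z w ^+ 2)%:E).
  by apply/measurable_EFinP; exact: measurable_funX.
have iZ2 : P.-integrable [set: T] (fun w => (Z w ^+ 2)%:E).
  apply/integrableP; split=> //.
  by under eq_integral do rewrite /= ger0_norm ?sqr_ge0//.
have i1 : P.-integrable [set: T] (fun w => (cst 1 w)%:E).
  exact: finite_measure_integrable_cst.
apply: (le_integrable _ _ _ (integrableD measurableT i1 iZ2)) => //=.
  exact/measurable_EFinP.
move=> w _; rewrite lee_fin [leRHS]ger0_norm ?addr_ge0 ?sqr_ge0//.
have := sqr_ge0 (`|Z w| - 1); rewrite sqrrB1 real_normK ?num_real//.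
have := normr_ge0 (Z w); lra.
Qed.

(* [1 + r Z <= expR (r Z)] makes the exponent of the moment generating function
   nonnegative for all [r], which forces its linear coefficient to vanish. *)
Lemma centred_mgf (Z : {RV P >-> R}) (m s : R) :
  P.-integrable [set: T] (EFin \o Z) -> ('E_P[Z] = 0)%E ->
  (forall r, ('M_P Z r = (expR (r * m + (r * s) ^+ 2 / 2))%:E)%E) -> m = 0.
Proof.
rewrite expectation_def => iZ EZ mgf.
have key r : 0 <= r * m + (r * s) ^+ 2 / 2.
  rewrite -ler_expR expR0 -lee_fin -mgf /mmt_gen_fun unlock.
  have i1 : P.-integrable [set: T] (cst 1%:E).
    exact: finite_measure_integrable_cst.
  have irZ := integrableZl measurableT r iZ.
  have -> : (1%:E = \int[P]_w (cst 1%:E w + r%:E * (Z w)%:E))%E.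
    rewrite integralD// integralZl// EZ mule0 adde0 integral_cst//.
    by rewrite mul1e; exact/esym/probability_setT.
  apply: le_integral => //; first exact: integrableD.
    apply/integrableP; split.
      exact/measurable_EFinP/measurableT_comp.
    under eq_integral do rewrite /= ger0_norm ?expR_ge0//.
    have := mgf r; rewrite /mmt_gen_fun unlock => /= ->.
    exact: ltry.
  by move=> w _; rewrite -EFinM -EFinD lee_fin/= mulrC expR_ge1Dx.
apply/eqP; apply/negPn/negP => m0.
have m2 : 0 < m ^+ 2 by rewrite exprn_even_gt0.
have s2 : 0 < s ^+ 2 + 1 by rewrite ltr_wpDl ?sqr_ge0.
(* For [s != 0] the quadratic is minimal at [- m / s ^+ 2]; adding 1 to the denominator also covers
   [s = 0] and still gives a negative value. *)
have := key (- m / (s ^+ 2 + 1)).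
have -> : - m / (s ^+ 2 + 1) * m + (- m / (s ^+ 2 + 1) * s) ^+ 2 / 2 =
  - (m ^+ 2 * (s ^+ 2 + 2)) / (2 * (s ^+ 2 + 1) ^+ 2).
  field; exact: lt0r_neq0.
rewrite mulNr oppr_ge0 leNgt divr_gt0// mulr_gt0//; last by rewrite exprn_gt0.
by rewrite ltr_wpDl ?sqr_ge0.
Qed.

End gaussian_rv.

(** With zero mean the exponent is [(r * s) ^+ 2 / 2], and [s ^+ 2 <= 8 * V] gives the factor 4. *)
Lemma gaussian_process_mgf_le {d : measure_display} {T : measurableType d}
    {R : realType} (P : probability T R) (Z : R -> {RV P >-> R}) (x V r : R) :
  gaussian_process Z -> centred_process Z -> 0 <= x ->
  ('E_P[(fun w => (Z x w ^+ 2)%R)] <= V%:E)%E ->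
  ('M_P (Z x) r <= (expR (4 * r ^+ 2 * V))%:E)%E.
Proof.
move=> gZ cZ x0 EV.
have law : gaussian_law (fun A => P (Z x @^-1` A)).
  have := gZ 1%N (fun=> 1) (fun=> x) (fun=> x0).
  rewrite (_ : (fun w => _) = Z x)//.
  by apply/funext => w; rewrite big_ord1 mul1r.
have [m [s [s0 mgf sV]]] := gaussian_law_mgf law.
have iZ := sqr_integrable (le_lt_trans EV (ltry _)).
have m0 := centred_mgf iZ (cZ x x0) mgf.
rewrite mgf m0 mulr0 add0r lee_fin ler_expR.
have := le_trans sV EV; rewrite lee_fin => s2V.
rewrite exprMn; have := sqr_ge0 r; nra.
Qed.

(** * Growth estimates, levels of the solution and summability *)

Lemma powR_le_linear {R : realType} (b gamma : R) :
  0 <= b -> 0 < gamma -> gamma < 1 ->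
  exists K : R, forall x, 0 <= x -> b * x `^ gamma <= x + K.
Proof.
move=> b0 g0 g1; have g'0 : 0 < 1 - gamma by rewrite subr_gt0.
pose x0 := b `^ (1 - gamma)^-1.
have x0_ge0 : 0 <= x0 by exact: powR_ge0.
exists (b * x0 `^ gamma) => x x_ge0.
have [xx0|x0x] := leP x x0.
  rewrite ler_wpDl// ler_wpM2l// ge0_ler_powR ?nnegrE//; exact: ltW.
rewrite ler_wpDr ?mulr_ge0 ?powR_ge0//.
have bE : b = x0 `^ (1 - gamma) by rewrite -powRrM mulVf ?gt_eqF// powRr1.
have bx : b <= x `^ (1 - gamma).
  by rewrite bE ge0_ler_powR ?nnegrE ?(ltW g'0) ?(ltW x0x).
rewrite (le_trans (ler_wpM2r (powR_ge0 _ _) bx))// -powRD ?subrK ?powRr1//.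
by rewrite oner_eq0.
Qed.

Lemma C0path_bounded {R : realType} (f : R -> R) (t : R) :
  C0path f -> 0 <= t ->
  exists2 M : R, 0 <= M & forall s, 0 <= s -> s <= t -> f s <= M.
Proof.
move=> [f0 cf] t0.
have ct : {within `[0, t], continuous f}.
  by apply: continuous_subspaceW cf => s; rewrite /= in_itv/= => /andP[].
have [c ct0 fc] := EVT_max t0 ct; exists (f c).
  by rewrite -f0 fc// in_itv/= lexx.
by move=> s s0 st; rewrite fc// in_itv/= s0.
Qed.

Lemma solves_ivp_level {R : realType} (sigma kappa v M : R) (theta z f : R -> R)
    (t x : R) :
  0 < kappa -> 0 <= v -> 0 <= M ->
  (forall s, 0 <= s -> s <= t -> theta s <= M) -> z 0 = 0 ->
  solves_ivp (Yfield sigma kappa v theta z) f ->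
  0 <= t -> 0 <= x -> x <= f t ->
  0 <= sigma * z x - kappa * x + (kappa * M + v).
Proof.
move=> k0 v0 M0 tM z0 [f0 _ [f' [df _ f'E]]] t0.
(* Level 0 has no positive hitting argument; there [z 0 = 0] leaves only [kappa * M + v]. *)
rewrite le_eqVlt => /predU1P[<- _|x0 xt].
  by rewrite z0 !mulr0 subrr add0r addr_ge0// mulr_ge0// ltW.
have [s [s0 st fs]] := exists_hit_derivative_ge0 df f0 t0 x0 xt.
rewrite f'E// fs /Yfield => /le_trans; apply.
have : kappa * theta s <= kappa * M by rewrite ler_pM2l// tM.
lra.
Qed.

Lemma nneseries_geometric_lty {R : realType} (u : nat -> \bar R) (a z : R) :
  0 <= a -> 0 < z -> z < 1 -> (forall n, 0 <= u n)%E ->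
  (forall n, (u n <= (a * z ^+ n)%:E)%E) -> (\sum_(n <oo) u n < +oo)%E.
Proof.
move=> a0 z0 z1 u0 ua; have z1' : 0 < 1 - z by rewrite subr_gt0.
apply: (@le_lt_trans _ _ (a / (1 - z))%:E); last exact: ltry.
apply: lime_le; first exact: is_cvg_nneseries.
apply: nearW => n.
apply: (@le_trans _ _ (\sum_(0 <= i < n) (a * z ^+ i)%:E)%E).
  by apply: lee_sum => i _.
rewrite sumEFin lee_fin.
have := geometric_seriesE a (negbT (lt_eqF z1)) => /(congr1 (fun f => f n)).
rewrite /series/= => ->.
by rewrite ler_pM2r ?invr_gt0// ler_piMr// gerBl exprn_ge0// ltW.
Qed.

Theorem mainTheorem12 (R : realType) (d : measure_display)
  (T : measurableType d) (P : probability T R)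
  (Z : R -> {RV P >-> R})
  (Zpaths : {ae P, forall w, C0path (fun x => Z x w)})
  (Zgaussian : gaussian_process Z)
  (Zcentred : centred_process Z)
  (alpha beta gamma : R)
  (alpha_ge0 : 0 <= alpha) (beta_ge0 : 0 <= beta)
  (gamma_gt0 : 0 < gamma) (gamma_lt1 : gamma < 1)
  (Zvar : forall x, 0 <= x ->
    ('E_P[(fun w => (Z x w ^+ 2)%R)] < (alpha + beta * x `^ gamma)%R%:E)%E)
  (sigma kappa v : R) (theta : R -> R)
  (sigma_gt0 : 0 < sigma) (kappa_gt0 : 0 < kappa) (v_ge0 : 0 <= v)
  (theta_path : C0path theta) (theta_bij : set_bij Rplus Rplus theta)
  (Zsup : {ae P, forall w,
    ereal_sup [set (kappa * x - sigma * Z x w)%:E | x in Rplus] = +oo%E})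
  (X : R -> {RV P >-> R})
  (Xsol : {ae P, forall w,
    solves_ivp (Yfield sigma kappa v theta (fun x => Z x w))
               (fun t => X t w)}) :
  forall p t : R, 0 <= t -> 'M_P (X t) p \is a fin_num.
Proof.
move=> p t t0.
have [M M0 tM] := C0path_bounded theta_path t0.
(* With [lam * kappa = q + 2] the linear part of the exponent is [- 2 * n]: one [n] absorbs the
   variance term through [HK], the other leaves the ratio [expR (- 1)]. *)
pose c := kappa * M + v; pose q := `|p|; pose lam := (q + 2) / kappa.
have q0 : 0 <= q by exact: normr_ge0.
have lam0 : 0 <= lam by rewrite divr_ge0 ?addr_ge0// ltW.
have lamk : lam * kappa = q + 2 by rewrite divfK// gt_eqF.
have [K HK] := @powR_le_linear R (4 * (lam * sigma) ^+ 2 * beta) gamma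
  (mulr_ge0 (mulr_ge0 (ler0n _ 4) (sqr_ge0 _)) beta_ge0) gamma_gt0 gamma_lt1.
(* [h n] is the deterministic part of the exponent; only the second factor of [g n] is random. *)
pose h n := q * n.+1%:R + lam * (c - kappa * n%:R).
pose g n w := ((expR (h n))%:E * (expR (lam * sigma * Z n%:R w))%:E)%E.
have g0 n w : (0 <= g n w)%E by rewrite mule_ge0// lee_fin expR_ge0.
have mexp (Y : {RV P >-> R}) r :
    measurable_fun [set: T] (fun w => (expR (r * Y w))%:E).
  exact: measurableT_comp (measurable_expRM r) (measurable_funPT Y).
have mg n : measurable_fun [set: T] (g n).
  by apply: measurable_funeM; exact: mexp.
have mgfE (Y : {RV P >-> R}) r :
    ('M_P Y r = \int[P]_w (expR (r * Y w))%:E)%E.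
  rewrite /mmt_gen_fun unlock; apply: eq_integral => w _ /=.
  by rewrite mulrC.
rewrite ge0_fin_numE; last first.
  by rewrite mgfE integral_ge0// => w _; rewrite lee_fin expR_ge0.
apply: (@le_lt_trans _ _ (\int[P]_w \sum_(n <oo) g n w)%E).
  rewrite mgfE; apply: ae_ge0_le_integral => //.
  - by move=> w _; exact: nneseries_ge0.
  - by apply: ge0_emeasurable_sum.
  - near=> w => _.
    have solw : solves_ivp (Yfield sigma kappa v theta (fun x => Z x w))
               (fun t => X t w) by near: w; exact: Xsol.
    have [Z0 _] : C0path (fun x => Z x w) by near: w; exact: Zpaths.
    have X0 : 0 <= X t w by case: solw => _ /(_ t t0).
    pose n := Num.truncn (X t w).
    have /andP[nX Xn] : n%:R <= X t w < n.+1%:R by exact: truncn_itv.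
    have lev :=
      solves_ivp_level kappa_gt0 v_ge0 M0 tM Z0 solw t0 (ler0n _ n) nX.
    apply: (@le_trans _ _ (g n w)).
      rewrite /g -EFinM -expRD lee_fin ler_expR /h.
      have : p * X t w <= q * n.+1%:R.
        rewrite (le_trans (ler_norm _))// normrM (ger0_norm X0).
        by rewrite ler_wpM2l// ltW.
      have := mulr_ge0 lam0 lev; rewrite -/c; lra.
    (* The random index [n] is removed by bounding its term by the whole nonnegative series; the
       partial sum up to [n.+1] has this term last. *)
    have := nneseries_lim_ge n.+1 (fun i (_ : (0 <= i)%N) (_ : true) => g0 i w).
    apply: le_trans; rewrite big_nat_recr//= leeDr//.
    by apply: sume_ge0.
rewrite integral_nneseries//.
pose A := 4 * (lam * sigma) ^+ 2 * alpha.
(* The constant collects [q + lam * c] from [h n], [A] from the [alpha] part of the variance bound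
   and [K] from its [beta] part. *)
apply: (@nneseries_geometric_lty _ _ (expR (q + lam * c + A + K)) (expR (- 1))).
- exact: expR_ge0.
- exact: expR_gt0.
- by rewrite expR_lt1 ltrN10.
- by move=> n; apply: integral_ge0.
- move=> n; rewrite ge0_integralZl_EFin ?expR_ge0//.
  rewrite -mgfE.
  have := gaussian_process_mgf_le (lam * sigma) Zgaussian Zcentred (ler0n _ n)
    (ltW (Zvar _ (ler0n _ n))).
  move=> /(lee_wpmul2l (_ : 0 <= (expR (h n))%:E)%E).
  rewrite lee_fin expR_ge0 => /(_ isT)/le_trans; apply.
  rewrite -EFinM -expRD -expRM_natl -expRD lee_fin ler_expR.
  have := HK n%:R (ler0n _ n); have : lam * (kappa * n%:R) = (q + 2) * n%:R.
    by rewrite mulrA lamk.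
  rewrite /h /A -[n.+1]addn1 natrD; set u := _ `^ _; lra.
Unshelve. all: by end_near. Qed.
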